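(* Consider a balanced realization of a Coxeter system $(W,S)$ over a commutative domain $\Bbbk$ with all $\alpha_u\ne0$, and let $s\neq t\in S$ with $m=m_{st}<\infty$. Let $\underline x=(s,t,s,\dots)$ and $\underline y=(t,s,t,\dots)$ be the alternating expressions of length $m$, let $f:\Lambda(\underline x\,\underline y^{\mathrm{rev}})\to r_{\mathrm{id}}$ be the morphism in $(\Omega_QW)_\oplus$ whose component at a subexpression is $\pi_{s,t}$ if its endpoint is $\mathrm{id}$ and $0$ otherwise, and let $$G=(f\otimes\mathrm{id}_{\Lambda(\underline y)})\circ(\mathrm{id}_{\Lambda(\underline x)}\otimes C_{\underline y}):\Lambda(\underline x)\to\Lambda(\underline y)$$ where $C_{\underline y}:r_{\mathrm{id}}\to\Lambda(\underline y^{\mathrm{rev}})\otimes\Lambda(\underline y)$ is the nested cup morphism (so $G$ is the image $\Lambda(G_{s,t})$ of the $2m$-valent vertex under the localization functor). If $\underline e\subset\underline x$ and $\underline e'\subset\underline y$ are subexpressions with the same endpoint, then the component of $G$ from the summand $\underline e$ to the summand $\underline e'$ is $$G_{\underline e}^{\underline e'}=\frac{\pi_{s,t}}{\zeta(\underline e')}.$$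
   Context: Realization: a free finite rank $\Bbbk$-module $\mathfrak h$ with $\alpha_u^\vee\in\mathfrak h$, $\alpha_u\in\mathfrak h^*$ ($u\in S$), $\langle\alpha_u^\vee,\alpha_u\rangle=2$, such that $u(\lambda)=\lambda-\langle\alpha_u^\vee,\lambda\rangle\alpha_u$ defines an action of $W$ on $\mathfrak h^*$, and $[m_{st}]_s=[m_{st}]_t=0$ in $\Bbbk$ whenever $m_{st}<\infty$, where the two-colored quantum numbers are defined by $[0]=0,[1]=1$, $[2]_s=-\langle\alpha_s^\vee,\alpha_t\rangle$, $[2]_t=-\langle\alpha_t^\vee,\alpha_s\rangle$, $[n+1]_s=[n]_t[2]_s-[n-1]_s$, $[n+1]_t=[n]_s[2]_t-[n-1]_t$. Balanced: $[m_{st}-1]_s=[m_{st}-1]_t=1$ whenever $m_{st}<\infty$. $R=\mathrm{Sym}(\mathfrak h^* )$, $Q=\mathrm{Frac}(R)$, with induced $W$-action. $\Omega_QW$: monoidal category with objects $r_x$ ($x\in W$), $\mathrm{End}(r_x)=Q$, $\mathrm{Hom}(r_x,r_y)=0$ for $x\ne y$, $r_x\otimes r_y=r_{xy}$, and $g\otimes h=g\,x(h)$ for $g\in\mathrm{End}(r_x)$, $h\in\mathrm{End}(r_y)$; $(\Omega_QW)_\oplus$ is its additive envelope. For an expression $\underline w=(s_1,\dots,s_d)$, $\Lambda(\underline w)=(r_{\mathrm{id}}\oplus r_{s_1})\otimes\cdots\otimes(r_{\mathrm{id}}\oplus r_{s_d})=\bigoplus_{\underline e\in\{0,1\}^d}r_{s_1^{e_1}\cdots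 s_d^{e_d}}$; $\underline e$ is called a subexpression and $s_1^{e_1}\cdots s_d^{e_d}$ its endpoint. Morphisms are matrices over $Q$ indexed by subexpressions. $\underline w^{\mathrm{rev}}$ is the reversed expression, juxtaposition is concatenation. For $u\in S$, $\mathrm{cup}_u:r_{\mathrm{id}}\to\Lambda((u,u))$ has components $1/\alpha_u$ at $00$, $-1/\alpha_u$ at $11$, $0$ at $01,10$. Nested cups: $C_\emptyset=\mathrm{id}$ and, for $\underline y=(y_1,\dots,y_k)$ and $\underline y'=(y_1,\dots,y_{k-1})$, $C_{\underline y}=(\mathrm{id}_{\Lambda((y_k))}\otimes C_{\underline y'}\otimes\mathrm{id}_{\Lambda((y_k))})\circ\mathrm{cup}_{y_k}$. $\pi_{s,t}=\alpha_s\cdot s(\alpha_t)\cdot st(\alpha_s)\cdots$ ($m$ factors). For $\underline e'\subset\underline y=(y_1,\dots,y_m)$, $\zeta(\underline e')=\prod_{i=1}^m y_1^{e'_1}y_2^{e'_2}\cdots y_{i-1}^{e'_{i-1}}(\alpha_{y_i})$. *)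

(* Defs.v *)
From HB Require Import structures.
From mathcomp Require Import all_boot all_algebra.
From mathcomp Require Import fraction mpoly.

Set Implicit Arguments.
Unset Strict Implicit.
Unset Printing Implicit Defensive.

Import GRing.Theory.
Local Open Scope ring_scope.

(* [W] is the group presented by the generators [cgen s] and the relations
   [(cgen s * cgen t) ^+ m_st = 1]; it may be infinite.  The value
   [mcox s t = 0] encodes m_st = infinity (no relation). *)
Record coxeterSystem (W : groupType) (S : eqType) := CoxeterSystem {
  cgen : S -> W;
  mcox : S -> S -> nat;
  mcox_diag : forall s, mcox s s = 1%N;
  mcox_sym : forall s t, mcox s t = mcox t s;
  mcox_neq1 : forall s t, s != t -> mcox s t != 1%N;
  cox_rel : forall s t, ((cgen s * cgen t) ^+ mcox s t)%g = 1%g;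
  cox_univ : forall (G : groupType) (phi : S -> G),
    (forall s t, ((phi s * phi t) ^+ mcox s t)%g = 1%g) ->
    exists psi : {multiplicative W -> G},
      (forall s, psi (cgen s) = phi s) /\
      (forall psi' : {multiplicative W -> G},
         (forall s, psi' (cgen s) = phi s) -> psi' =1 psi)
}.

(* [qnum [2]_s [2]_t n] is [n]_s; by symmetry, [qnum [2]_t [2]_s n] is [n]_t. *)
Fixpoint qnum (k : pzRingType) (a b : k) (n : nat) : k :=
  match n with
  | 0 => 0
  | n1.+1 => match n1 with
             | 0 => 1
             | n2.+1 => qnum b a n1 * a - qnum a b n2
             end
  end.

(* Over a ring, [vectType k] is the type of free [k]-modules of finite rank.
   The pairing <alpha_s^vee, alpha_t> is [alpha t (alphav s)].  The W-action on
   h^* is determined by the reflection formula, since [cgen] generates [W].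
   The condition on two-colored quantum numbers only makes sense for s <> t
   (for s = t it would read 1 = 0). *)
Record realization (k : idomainType) (W : groupType) (S : eqType)
    (C : coxeterSystem W S) := Realization {
  hmod : vectType k;
  alphav : S -> hmod;
  alpha : S -> 'Hom(hmod, k^o);
  actdual : W -> 'End('Hom(hmod, k^o));
  alpha_alphav : forall u, alpha u (alphav u) = 2%:R;
  actdual1 : forall l, actdual 1%g l = l;
  actdualM : forall x y l, actdual (x * y)%g l = actdual x (actdual y l);
  actdual_gen : forall u l,
    actdual (cgen C u) l = l - (l (alphav u) : k) *: alpha u;
  qnum_mcox : forall s t, s != t -> (0 < mcox C s t)%N ->
    let two_s := - (alpha t (alphav s) : k) in
    let two_t := - (alpha s (alphav t) : k) in
    qnum two_s two_t (mcox C s t) = 0 /\ qnum two_t two_s (mcox C s t) = 0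
}.

Definition balanced (k : idomainType) (W : groupType) (S : eqType)
    (C : coxeterSystem W S) (V : realization k C) : Prop :=
  forall s t, s != t -> (0 < mcox C s t)%N ->
    let two_s := - (alpha V t (alphav V s) : k) in
    let two_t := - (alpha V s (alphav V t) : k) in
    qnum two_s two_t (mcox C s t).-1 = 1 /\
    qnum two_t two_s (mcox C s t).-1 = 1.

(* The symmetric algebra of a free module M of finite rank, as the polynomial
   algebra on the coordinates of M given by [v2r]/[r2v] (which are the only
   coordinates the library provides over a ring). *)
Section SymmetricAlgebra.
Variables (k : idomainType) (M : vectType k).
Import VectorInternalTheory.

Definition Sym := {mpoly k[dim M]}.

Definition sym_in (v : M) : Sym := \sum_(i < dim M) v2r v 0 i *: 'X_i.

Definition sym_basis (i : 'I_(dim M)) : M := r2v (delta_mx 0 i).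

(* The k-algebra endomorphism of Sym(M) extending g : M -> M. *)
Definition sym_map (g : 'End(M)) (p : Sym) : Sym :=
  p \mPo [tuple sym_in (g (sym_basis i)) | i < dim M].

HB.instance Definition _ (g : 'End(M)) := GRing.RMorphism.copy (sym_map g)
  (fun p => p \mPo [tuple sym_in (g (sym_basis i)) | i < dim M]).

Lemma sym_in_lin : linear sym_in.
Proof.
move=> a u v; rewrite /sym_in scaler_sumr -big_split /=; apply: eq_bigr => i _.
by rewrite linearP !mxE scalerDl scalerA.
Qed.

HB.instance Definition _ :=
  GRing.isLinear.Build k M {mpoly k[dim M]} _ sym_in sym_in_lin.

Lemma sym_map_in (g : 'End(M)) (v : M) : sym_map g (sym_in v) = sym_in (g v).
Proof.
rewrite {1}/sym_in rmorph_sum /=.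
rewrite -[v in RHS]v2rK [v2r v in RHS]row_sum_delta !linear_sum /=.
apply: eq_bigr => i _; rewrite !linearZ /= /sym_map comp_mpolyZ comp_mpolyXU.
by rewrite -tnth_nth tnth_mktuple.
Qed.

End SymmetricAlgebra.

(* The map induced by [g] on fractions, p/q |-> g(p)/g(q), computed on a chosen
   representative; it does not depend on the choice when [g] is an injective
   ring morphism (see [frac_map_frac]). *)
Definition frac_map (R : idomainType) (g : R -> R) (q : {fraction R}) :
    {fraction R} :=
  tofrac (g \n_(repr q)) / tofrac (g \d_(repr q)).

Lemma frac_map0 (R : idomainType) (g : R -> R) : g 0 = 0 -> frac_map g 0 = 0.
Proof.
move=> g0; rewrite /frac_map; set x := repr _.
suff /eqP -> : (frac x).1 == 0 by rewrite g0 tofrac0 mul0r.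
rewrite FracField.numer0; apply/eqP; rewrite /x reprK -tofrac0.
unlock FracField.tofrac; congr (\pi_({fraction R}) _)%qT; apply: val_inj.
by rewrite /Ratio /insubd insubT ?oner_neq0.
Qed.

Section FracMap.
Variables (R : idomainType) (g : {rmorphism R -> R}).
Hypothesis ginj : injective g.

Lemma frac_repr (x : {fraction R}) :
  x = tofrac (frac (repr x)).1 / tofrac (frac (repr x)).2.
Proof.
have d0 := denom_ratioP (repr x).
apply: (canRL (mulfK _)); first by rewrite tofrac_eq0.
have E : x = \pi_({fraction R})%qT (repr x) by rewrite reprK.
move: (repr x) d0 E => r d0 ->; unlock FracField.tofrac.
rewrite -[LHS]FracField.pi_mul; apply/eqP; rewrite FracField.equivf_def.
rewrite /FracField.mulf !numden_Ratio ?oner_neq0 ?mulr1 //.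
by rewrite mulrC.
Qed.

Lemma frac_map_frac n d : d != 0 ->
  frac_map g (tofrac n / tofrac d) = tofrac (g n) / tofrac (g d).
Proof.
move=> d0; rewrite /frac_map; set x := (X in repr X).
have := frac_repr x; have d1 := denom_ratioP (repr x).
have gd1 : g (frac (repr x)).2 != 0 by rewrite -(rmorph0 g) (inj_eq ginj).
have gd0 : g d != 0 by rewrite -(rmorph0 g) (inj_eq ginj).
move/eqP; rewrite {1}/x (can2_eq (mulfVK _) (mulfK _)) ?tofrac_eq0 //.
rewrite mulrAC eq_sym (can2_eq (mulfVK _) (mulfK _)) ?tofrac_eq0 //.
rewrite -!tofracM tofrac_eq => /eqP e.
apply/eqP; rewrite (can2_eq (mulfVK _) (mulfK _)) ?tofrac_eq0 // mulrAC.
rewrite eq_sym (can2_eq (mulfVK _) (mulfK _)) ?tofrac_eq0 //.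
by rewrite -!tofracM tofrac_eq -!rmorphM e.
Qed.

End FracMap.

Section Localization.
Variables (k : idomainType) (W : groupType) (S : eqType).
Variables (C : coxeterSystem W S) (V : realization k C).

Definition Qfrac := {fraction (Sym 'Hom(hmod V, k^o))}.

Definition actQ (w : W) (q : Qfrac) : Qfrac :=
  frac_map (sym_map (actdual V w)) q.

Definition rootQ (u : S) : Qfrac := tofrac (sym_in (alpha V u)).

Lemma actQ0 w : actQ w 0 = 0.
Proof. by apply: frac_map0; rewrite /sym_map comp_mpoly0. Qed.

(* The formal direct sum of the r_(lab i), i ranging over [idx]. *)
Record obj := Obj { idx : finType; lab : idx -> W }.

(* [phi i j] is the component from the summand i of A to the summand j of B;
   it lies in Hom(r_(lab i), r_(lab j)). *)
Record mor (A B : obj) := Mor {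
  entry :> idx A -> idx B -> Qfrac;
  entry_supp : forall i j, lab i != lab j -> entry i j = 0
}.

Fact id_supp A (i j : idx A) : lab i != lab j -> (i == j)%:R = 0 :> Qfrac.
Proof. by case: (i =P j) => [->|//]; rewrite eqxx. Qed.

Definition idmor A : mor A A := Mor (@id_supp A).

Fact comp_supp A B D (g : mor B D) (f : mor A B) (i : idx A) (l : idx D) :
  lab i != lab l -> \sum_(j : idx B) f i j * g j l = 0.
Proof.
move=> il; rewrite big1 // => j _.
have [ij|/entry_supp->] := eqVneq (lab i) (lab j); last by rewrite mul0r.
by rewrite (@entry_supp _ _ g) ?mulr0 // -ij.
Qed.

(* [compmor g f] is the composite g o f. *)
Definition compmor A B D (g : mor B D) (f : mor A B) : mor A D :=
  Mor (comp_supp g f).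

Definition tensor_obj (A B : obj) : obj :=
  Obj (fun p : idx A * idx B => (lab p.1 * lab p.2)%g).

Fact tensor_supp A A' B B' (phi : mor A A') (psi : mor B B')
    (p : idx (tensor_obj A B)) (q : idx (tensor_obj A' B')) :
  lab p != lab q -> phi p.1 q.1 * actQ (lab p.1) (psi p.2 q.2) = 0.
Proof.
move=> /= pq.
have [e1|/entry_supp->] := eqVneq (lab p.1) (lab q.1); last by rewrite mul0r.
have [e2|/entry_supp->] := eqVneq (lab p.2) (lab q.2).
  by rewrite e1 e2 eqxx in pq.
by rewrite actQ0 mulr0.
Qed.

Definition tensor A A' B B' (phi : mor A A') (psi : mor B B') :
    mor (tensor_obj A B) (tensor_obj A' B') :=
  Mor (tensor_supp phi psi).

(* Transport of a morphism along relabellings of the summands of its source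
   and target; below, the relabellings are bijections. *)
Fact reindex_supp A A' B B' (h : idx A -> idx A') (h' : idx B -> idx B')
    (hh : forall i, lab (h i) = lab i) (hh' : forall j, lab (h' j) = lab j)
    (phi : mor A' B') (i : idx A) (j : idx B) :
  lab i != lab j -> phi (h i) (h' j) = 0.
Proof. by rewrite -hh -hh'; apply: entry_supp. Qed.

Definition reindex A A' B B' (h : idx A -> idx A') (h' : idx B -> idx B')
    (hh : forall i, lab (h i) = lab i) (hh' : forall j, lab (h' j) = lab j)
    (phi : mor A' B') : mor A B :=
  Mor (reindex_supp hh hh' phi).

Definition subexpr (w : seq S) := (size w).-tuple bool.

Definition endpoint (w : seq S) (e : seq bool) : W :=
  (\prod_(p <- zip w e) cgen C p.1 ^+ p.2)%g.

(* Lambda of the empty expression is r_id, the unit object. *)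
Definition Lam (w : seq S) : obj := Obj (fun e : subexpr w => endpoint w e).

(* The identification of Lambda(v ++ w) with Lambda(v) (x) Lambda(w):
   a subexpression of v ++ w is a pair of subexpressions of v and w. *)
Fact sub_left_proof v w (e : subexpr (v ++ w)) :
  size (take (size v) e) == size v.
Proof. by rewrite size_takel // size_tuple size_cat leq_addr. Qed.

Fact sub_right_proof v w (e : subexpr (v ++ w)) :
  size (drop (size v) e) == size w.
Proof. by rewrite size_drop size_tuple size_cat addKn. Qed.

Definition sub_split v w (e : idx (Lam (v ++ w))) :
    idx (tensor_obj (Lam v) (Lam w)) :=
  (Tuple (sub_left_proof e), Tuple (sub_right_proof e)).

Fact sub_split_lab v w (e : idx (Lam (v ++ w))) : lab (sub_split e) = lab e.
Proof.
rewrite /= /endpoint -big_cat -zip_cat ?cat_take_drop //.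
by rewrite (eqP (sub_left_proof e)).
Qed.

(* The tensor product of morphisms between objects Lambda(w), under the
   identification above. *)
Definition tensorL v v' w w' (phi : mor (Lam v) (Lam v'))
    (psi : mor (Lam w) (Lam w')) : mor (Lam (v ++ w)) (Lam (v' ++ w')) :=
  reindex (@sub_split_lab v w) (@sub_split_lab v' w') (tensor phi psi).

Definition castL v v' w w' (ev : v = v') (ew : w = w')
    (phi : mor (Lam v) (Lam w)) : mor (Lam v') (Lam w') :=
  ecast z (mor (Lam z) (Lam w')) ev (ecast z (mor (Lam v) (Lam z)) ew phi).

Definition cup_entry (u : S) (e : seq bool) : Qfrac :=
  if e == [:: false; false] then (rootQ u)^-1
  else if e == [:: true; true] then - (rootQ u)^-1
  else 0.

Fact cup_supp u (i : idx (Lam [::])) (j : idx (Lam [:: u; u])) :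
  lab i != lab j -> cup_entry u j = 0.
Proof.
rewrite /= /endpoint (tuple0 i) big_nil /cup_entry => /negP ij.
case: eqP => [ej|_].
  by case: ij; rewrite ej /= !big_cons big_nil /= !expg0 !mulg1.
case: eqP => [ej|//].
have := cox_rel C u u; rewrite mcox_diag expg1 => uu.
by case: ij; rewrite ej /= !big_cons big_nil /= !expg1 mulg1 uu.
Qed.

Definition cup (u : S) : mor (Lam [::]) (Lam [:: u; u]) := Mor (@cup_supp u).

Fact cups_cast u (z : seq S) :
  [:: u] ++ ((z ++ rev z) ++ [:: u]) = (u :: z) ++ rev (u :: z).
Proof. by rewrite rev_cons -cats1 /= catA. Qed.

(* [cups z] is C_(rev z): the first letter of [z] labels the outermost cup. *)
Fixpoint cups (z : seq S) : mor (Lam [::]) (Lam (z ++ rev z)) :=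
  match z with
  | [::] => idmor (Lam [::])
  | u :: z' =>
      castL (erefl [::]) (cups_cast u z')
        (compmor (tensorL (idmor (Lam [:: u]))
                          (tensorL (cups z') (idmor (Lam [:: u]))))
                 (cup u))
  end.

Definition nested_cup (y : seq S) : mor (Lam [::]) (Lam (rev y ++ y)) :=
  castL (erefl [::]) (congr1 (cat (rev y)) (revK y)) (cups (rev y)).

Fixpoint alt (s t : S) (m : nat) : seq S :=
  if m is m'.+1 then s :: alt t s m' else [::].

(* For w = (w_1, ..., w_d), [zeta w e] is the product over i of
   w_1^e_1 ... w_(i-1)^e_(i-1) (alpha_(w_i)). *)
Definition zeta (w : seq S) (e : subexpr w) : Qfrac :=
  \prod_(i < size w)
     actQ (endpoint (take i w) (take i e)) (rootQ (tnth (in_tuple w) i)).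

(* pi_(s,t) with m factors; [alt s t i] lists the letters of the i-th prefix
   s t s ..., and the next letter is s or t according to the parity of i. *)
Definition piQ (s t : S) (m : nat) : Qfrac :=
  \prod_(i < m)
     actQ (\prod_(u <- alt s t i) cgen C u)%g (rootQ (if odd i then t else s)).

Fact vertex_form_supp s t m w (i : idx (Lam w)) (j : idx (Lam [::])) :
  lab i != lab j -> (if endpoint w i == 1%g then piQ s t m else 0) = 0.
Proof. by rewrite /= /endpoint (tuple0 j) big_nil => /negPf->. Qed.

(* Lambda(x y^rev) -> r_id for the alternating expressions x = (s, t, ...) and
   y = (t, s, ...) of length m. *)
Definition vertex_form (s t : S) (m : nat) :
    mor (Lam (alt s t m ++ rev (alt t s m))) (Lam [::]) :=
  Mor (@vertex_form_supp s t m (alt s t m ++ rev (alt t s m))).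

Definition vertex (s t : S) (m : nat) :
    mor (Lam (alt s t m)) (Lam (alt t s m)) :=
  let x := alt s t m in let y := alt t s m in
  compmor (tensorL (vertex_form s t m) (idmor (Lam y)))
       (castL (cats0 x) (catA x (rev y) y)
          (tensorL (idmor (Lam x)) (nested_cup y))).

End Localization.

(* Main.v *)
Require Import Defs.
From mathcomp Require Import all_boot all_algebra.
From mathcomp Require Import fraction mpoly.

Set Implicit Arguments.
Unset Strict Implicit.
Unset Printing Implicit Defensive.

(* The coefficient of the nested cup on y at a pair of subexpressions (a, b) of
   y^rev and y vanishes unless a = rev b.  In that case, since
   -1/alpha_u = u(1/alpha_u), a cup on u with exponent b_u contributes
   u^(b_u)(1/alpha_u), and the product over all cups telescopes to
   w^-1(1/zeta(b)), where w is the endpoint of b.  In G, the form f then selects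
   b = e', and tensoring with the identity of the summand e on the left twists
   the coefficient by the endpoint of e, which is w and cancels w^-1. *)

Import GRing.Theory.
Local Open Scope ring_scope.

(** * Functoriality of the symmetric algebra *)

Section SymmetricAlgebraMap.
Variables (k : idomainType) (M : vectType k).
Import VectorInternalTheory.

Lemma sym_in_basis (i : 'I_(dim M)) : sym_in (sym_basis i) = 'X_i.
Proof.
rewrite /sym_in /sym_basis r2vK (bigD1 i) //= big1 => [|j ji].
  by rewrite mxE !eqxx scale1r addr0.
by rewrite mxE (negPf ji) andbF scale0r.
Qed.

Lemma sym_mapZ (g : 'End(M)) (a : k) (p : Sym M) :
  sym_map g (a *: p) = a *: sym_map g p.
Proof. exact: comp_mpolyZ. Qed.

(** Each monomial is a product of variables, and each variable is the image under [sym_in] of a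
    basis vector, so degree one determines everything. *)
Lemma eq_sym_rmorphism (f g : {rmorphism Sym M -> Sym M}) :
    (forall a p, f (a *: p) = a *: f p) ->
    (forall a p, g (a *: p) = a *: g p) ->
    (forall v, f (sym_in v) = g (sym_in v)) ->
  f =1 g.
Proof.
move=> fZ gZ fg p; rewrite [p]mpolyE !rmorph_sum /=; apply: eq_bigr => m _.
rewrite fZ gZ mpolyXE_id !rmorph_prod; congr (_ *: _); apply: eq_bigr => i _.
by rewrite !rmorphXn /= -sym_in_basis fg.
Qed.

Lemma sym_map_id (g : 'End(M)) : (forall v, g v = v) -> sym_map g =1 id.
Proof.
move=> gid; apply: (@eq_sym_rmorphism (sym_map g) idfun) => // [a p|v].
  exact: sym_mapZ.
by rewrite -[LHS]/(sym_map g _) sym_map_in gid.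
Qed.

Lemma sym_map_comp (g h gh : 'End(M)) : (forall v, gh v = g (h v)) ->
  sym_map gh =1 sym_map g \o sym_map h.
Proof.
move=> ghE; apply: (@eq_sym_rmorphism (sym_map gh) (sym_map g \o sym_map h)).
- exact: sym_mapZ.
- by move=> a p; rewrite -[LHS]/(sym_map g (sym_map h _)) !sym_mapZ.
- move=> v; rewrite -[LHS]/(sym_map gh _) -[RHS]/(sym_map g (sym_map h _)).
  by rewrite !sym_map_in ghE.
Qed.

End SymmetricAlgebraMap.

(** * The action of $W$ on $Q$ by field automorphisms *)

Section LocalizedAction.
Variables (k : idomainType) (W : groupType) (S : eqType).
Variables (C : coxeterSystem W S) (V : realization k C).
Local Notation act := (@actQ k W S C V).

Lemma sym_map_actM x y : sym_map (actdual V (x * y)%g) =1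
  sym_map (actdual V x) \o sym_map (actdual V y).
Proof. by apply: sym_map_comp => v; apply: actdualM. Qed.

Lemma sym_map_act1 : sym_map (actdual V 1%g) =1 id.
Proof. by apply: sym_map_id => v; apply: actdual1. Qed.

(** The map of $x^{-1}$ is a left inverse. Injectivity makes [frac_map] independent of the
    representative. *)
Lemma sym_map_act_inj x : injective (sym_map (actdual V x)).
Proof.
apply: (can_inj (g := sym_map (actdual V x^-1%g))) => p.
by have := sym_map_actM x^-1%g x p; rewrite /= mulVg sym_map_act1.
Qed.

Lemma actQ_frac x n d : d != 0 -> act x (tofrac n / tofrac d) =
  tofrac (sym_map (actdual V x) n) / tofrac (sym_map (actdual V x) d).
Proof. exact: frac_map_frac (@sym_map_act_inj x) _ _. Qed.

Lemma fracP (R : idomainType) (q : {fraction R}) :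
  exists n d, d != 0 /\ q = tofrac n / tofrac d.
Proof.
by exists (frac (repr q)).1, (frac (repr q)).2; split;
  [apply: denom_ratioP | apply: frac_repr].
Qed.

Lemma actQ_tofrac x p :
  act x (tofrac p) = tofrac (sym_map (actdual V x) p).
Proof.
have s1 : sym_map (actdual V x) 1 = 1 := rmorph1 _.
by have := @actQ_frac x p 1 (oner_neq0 _); rewrite s1 !tofrac1 !divr1.
Qed.

Lemma actQM x p q : act x (p * q) = act x p * act x q.
Proof.
have [n [d [d0 ->]]] := fracP p; have [n' [d' [d'0 ->]]] := fracP q.
rewrite mulf_div -!tofracM !actQ_frac ?mulf_neq0 // mulf_div.
by rewrite !rmorphM -!tofracM.
Qed.

Lemma actQV x q : act x q^-1 = (act x q)^-1.
Proof.
have [n [d [d0 ->]]] := fracP q; rewrite invf_div.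
(* The fraction inverts to one with denominator [n]; for [n = 0] the convention $0^{-1} = 0$ settles
   the claim. *)
have [->|n0] := eqVneq n 0.
  by rewrite tofrac0 mul0r invr0 mulr0 actQ0 invr0.
by rewrite !actQ_frac // invf_div.
Qed.

Lemma actQ1r x : act x 1 = 1.
Proof. by rewrite -tofrac1 actQ_tofrac rmorph1. Qed.

Lemma actQ_act1 q : act 1%g q = q.
Proof. by have [n [d [d0 ->]]] := fracP q; rewrite actQ_frac // !sym_map_act1. Qed.

Lemma actQ_actM x y q : act (x * y)%g q = act x (act y q).
Proof.
have [n [d [d0 ->]]] := fracP q.
rewrite !actQ_frac ?sym_map_actM //.
by rewrite -(rmorph0 (sym_map (actdual V y))) (inj_eq (@sym_map_act_inj y)).
Qed.

(** From $\langle\alpha_u^\vee,\alpha_u\rangle=2$: the reflection gives $\alpha_u-2\alpha_u$. *)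
Lemma actQ_root u : act (cgen C u) (rootQ V u) = - rootQ V u.
Proof.
rewrite /rootQ actQ_tofrac sym_map_in actdual_gen alpha_alphav scaler_nat.
by rewrite mulr2n opprD addNKr (raddfN (@sym_in _ _)) tofracN.
Qed.

End LocalizedAction.

(** * Endpoints of subexpressions *)

Section VertexCoefficients.
Variables (k : idomainType) (W : groupType) (S : eqType).
Variables (C : coxeterSystem W S) (V : realization k C).
Local Notation act := (@actQ k W S C V).

Lemma cgen_expV u (b : bool) : ((cgen C u ^+ b)^-1 = cgen C u ^+ b)%g.
Proof.
apply: mulg1_eq; case: b; last by rewrite mulg1.
by rewrite expg1 -[RHS](cox_rel C u u) mcox_diag.
Qed.

Lemma endpoint_nil e : endpoint C [::] e = 1%g.
Proof. by rewrite /endpoint; case: e => *; rewrite big_nil. Qed.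

Lemma endpoint_cons u w b e :
  endpoint C (u :: w) (b :: e) = (cgen C u ^+ b * endpoint C w e)%g.
Proof. by rewrite /endpoint big_cons. Qed.

Lemma endpoint_cat v w d e : size v = size d ->
  endpoint C (v ++ w) (d ++ e) = (endpoint C v d * endpoint C w e)%g.
Proof. by move=> vd; rewrite /endpoint zip_cat // big_cat. Qed.

Lemma endpoint_rcons w u e b : size w = size e ->
  endpoint C (rcons w u) (rcons e b) = (endpoint C w e * cgen C u ^+ b)%g.
Proof.
by move=> we; rewrite -!cats1 endpoint_cat // endpoint_cons endpoint_nil mulg1.
Qed.

Lemma endpoint_rev w e : size w = size e ->
  endpoint C (rev w) (rev e) = (endpoint C w e)^-1%g.
Proof.
elim: w e => [|u w IHw] [|b e] //= => [_|[we]].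
  by rewrite endpoint_nil invg1.
rewrite !rev_cons endpoint_rcons ?size_rev // IHw // endpoint_cons.
by rewrite invgM cgen_expV.
Qed.

(** * Matrix entries of casts, tensor products and nested cups *)

Lemma subexprP (w : seq S) (a : seq bool) : size a = size w ->
  exists e : subexpr w, tval e = a.
Proof. by move/eqP=> h; exists (Tuple h). Qed.

(** Comparing indices through [tval] avoids transporting tuples along equalities of expressions. *)
Lemma castLE v v' w w' (ev : v = v') (ew : w = w')
    (phi : mor V (Lam C v) (Lam C w))
    (i : subexpr v') (j : subexpr w') (i' : subexpr v) (j' : subexpr w) :
  tval i = tval i' -> tval j = tval j' -> castL ev ew phi i j = phi i' j'.
Proof. by case: v' / ev i => i; case: w' / ew j => j /= /val_inj-> /val_inj->. Qed.

Lemma sub_splitE v w (e : subexpr (v ++ w)) (e1 : subexpr v) (e2 : subexpr w) :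
  tval e = e1 ++ e2 -> @sub_split _ _ C _ _ e = (e1, e2).
Proof.
move=> eE; congr pair; apply: val_inj; rewrite /= eE.
  by rewrite take_size_cat ?size_tuple.
by rewrite drop_size_cat ?size_tuple.
Qed.

Lemma tensorLE v v' w w' (phi : mor V (Lam C v) (Lam C v'))
    (psi : mor V (Lam C w) (Lam C w'))
    (i : subexpr (v ++ w)) (j : subexpr (v' ++ w'))
    (i1 : subexpr v) (i2 : subexpr w) (j1 : subexpr v') (j2 : subexpr w') :
    tval i = i1 ++ i2 -> tval j = j1 ++ j2 ->
  tensorL phi psi i j = phi i1 j1 * act (endpoint C v i1) (psi i2 j2).
Proof.
move=> /sub_splitE ei /sub_splitE ej.
transitivity (tensor phi psi (@sub_split _ _ C _ _ i) (@sub_split _ _ C _ _ j)); first by [].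
by rewrite ei ej.
Qed.

(** With [z] read from the outermost cup inwards, this is $\prod_i z_1^{a_1}\cdots
    z_i^{a_i}(1/\alpha_{z_i})$: each cup is twisted by the left strands enclosing it. *)
Fixpoint cup_coeff (z : seq S) (a : seq bool) : Qfrac V :=
  match z, a with
  | u :: z', b :: a' => act (cgen C u ^+ b)%g (cup_coeff z' a' / rootQ V u)
  | _, _ => 1
  end.

(** Both nonzero entries of the cup equal $u^b(1/\alpha_u)$, which absorbs the sign; [q] stands for
    the coefficient of the inner cups, twisted by the left strand. *)
Lemma cup_entryE u b c (q : Qfrac V) :
  cup_entry V u [:: b; c] * act (cgen C u ^+ b)%g q =
    if c == b then act (cgen C u ^+ b)%g (q / rootQ V u) else 0.
Proof.
rewrite actQM actQV /cup_entry.
case: b c => [] [] //=; rewrite ?mul0r //.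
  by rewrite expg1 actQ_root invrN mulrC.
by rewrite expg0 !actQ_act1 mulrC.
Qed.

(** Induction peels off the outermost cup: its two feet must carry equal exponents, and its left
    foot twists the coefficient of the rest. *)
Lemma cupsE z (i : subexpr [::]) (e : subexpr (z ++ rev z)) :
  cups V z i e = if drop (size z) e == rev (take (size z) e)
                 then cup_coeff z (take (size z) e) else 0.
Proof.
elim: z i e => [|u z IHz] i e; first by rewrite /= (tuple0 i) (tuple0 e) eqxx.
(* Here [b] and [c] are the exponents at the feet of the outermost cup. *)
have [b [mid [c eE]]] : exists b (mid : subexpr (z ++ rev z)) c,
    tval e = b :: rcons mid c.
  case: e => -[|b e] //= /eqP[]; rewrite rev_cons -rcons_cat size_rcons.
  case/lastP: e => [|mid c] //; rewrite size_rcons => -[sz].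
  by have [m <-] := subexprP sz; exists b, m, c.
(* [j] is [e] read before the cast [cups_cast]. *)
have [|j jE] := @subexprP ([:: u] ++ ((z ++ rev z) ++ [:: u]))
  ([:: b] ++ (mid ++ [:: c])).
  by rewrite /= !size_cat size_tuple !size_cat.
pose T := tensorL (idmor V (Lam C [:: u]))
  (tensorL (cups V z) (idmor V (Lam C [:: u]))).
transitivity (\sum_(j0 : subexpr [:: u; u]) cup_entry V u j0 * T j0 j).
  rewrite -[RHS]/(compmor T (cup V u) i j).
  by apply: castLE; rewrite // jE eE /= cats1.
have [|mc mcE] := @subexprP ((z ++ rev z) ++ [:: u]) (mid ++ [:: c]).
  by rewrite /= !size_cat size_tuple !size_cat.
have TE (b0 c0 : bool) : T [tuple b0; c0] j =
    (b0 == b)%:R * act (cgen C u ^+ b0)%g (cups V z i mid * (c0 == c)%:R).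
  rewrite /T (@tensorLE [:: u] [:: u] [:: u] _ _ _ _ _ [tuple b0] [tuple c0] [tuple b] mc) //;
    last by rewrite jE mcE.
  rewrite (@tensorLE [::] _ [:: u] [:: u] _ _ _ _ i [tuple c0] mid [tuple c]) //;
    last by rewrite (tuple0 i).
  rewrite endpoint_cons !endpoint_nil mulg1 actQ_act1 /=.
  by rewrite -!(inj_eq val_inj) /= !eqseq_cons !andbT.
(* The identities on the two outer strands leave only the summand $(b,c)$. *)
clearbody T; rewrite (bigD1 [tuple b; c]) //= big1 ?addr0 => [|j0 j0bc];
  last first.
  have [b0 [c0 j0E]] : exists b0 c0, j0 = [tuple b0; c0].
    case: j0 {j0bc} => -[|b0 [|c0 []]] // ?; exists b0, c0; exact: val_inj.
  move: j0bc; rewrite j0E -(inj_eq val_inj) /= !eqseq_cons andbT.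
  rewrite TE; case: (b0 == b) => [|_]; last by rewrite mul0r mulr0.
  by move=> /= /negPf->; rewrite mulr0 actQ0 !mulr0.
rewrite TE !eqxx mulr1 mul1r cup_entryE IHz eE /= -cats1.
have szm : (size z <= size mid)%N by rewrite size_tuple size_cat leq_addr.
have -> : drop (size z) (mid ++ [:: c]) = rcons (drop (size z) mid) c.
  rewrite cats1 -[tval mid in LHS](cat_take_drop (size z)) rcons_cat.
  by rewrite drop_size_cat // size_takel.
(* The mirror condition on [e] splits into [c == b] and the mirror condition on [mid]. *)
rewrite takel_cat // rev_cons eqseq_rcons andbC.
case: (c == b) => //=; case: ifP => // _.
by rewrite mul0r actQ0.
Qed.

(** * Comparison of cup coefficients with $\zeta$, and the vertex *)

Lemma zeta_nth (u0 : S) w (e : subexpr w) : zeta V e =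
  \prod_(0 <= i < size w)
    act (endpoint C (take i w) (take i e)) (rootQ V (nth u0 w i)).
Proof.
by rewrite big_mkord; apply: eq_bigr => i _; rewrite (tnth_nth u0).
Qed.

(** The factor at a letter involves only the exponents before it, so the last exponent [b] never
    enters. *)
Lemma zeta_rcons w u (d : subexpr w) b (e : subexpr (rcons w u)) :
    tval e = rcons d b ->
  zeta V e = zeta V d * act (endpoint C w d) (rootQ V u).
Proof.
move=> eE; rewrite !(zeta_nth u) eE size_rcons big_nat_recr //=.
rewrite -!cats1 take_size_cat // take_size_cat ?size_tuple //.
rewrite nth_cat ltnn subnn /=; congr (_ * _).
rewrite [LHS]big_nat_cond [RHS]big_nat_cond.
apply: eq_bigr => i /andP[/andP[_ ilt] _].
by rewrite !takel_cat ?nth_cat ?ilt ?size_tuple // ltnW.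
Qed.

(* The last letter of [y] labels the outermost cup. *)
Lemma cup_coeff_rev (y : seq S) (e : subexpr y) :
  cup_coeff (rev y) (rev e) = act (endpoint C y e)^-1%g (zeta V e)^-1.
Proof.
elim/last_ind: y e => [|y u IHy] e.
  by rewrite (tuple0 e) /zeta big_ord0 invr1 actQ1r.
have [d [b eE]] : exists (d : subexpr y) b, tval e = rcons d b.
  case: e => e /=; rewrite size_rcons; case/lastP: e => // e b.
  by rewrite size_rcons => /eqP[/subexprP[d <-]]; exists d, b.
(* With $w$ the endpoint of [d], both sides become $u^b(w^{-1}(1/\zeta(d))/\alpha_u)$: the new
   factor $w(\alpha_u)$ of $\zeta$ is untwisted by $w^{-1}$. *)
rewrite (zeta_rcons eE) eE !rev_rcons /= IHy endpoint_rcons ?size_tuple //.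
rewrite invgM cgen_expV actQ_actM invfM.
rewrite [act _^-1%g (_ * _)]actQM -[(act _ (rootQ V u))^-1]actQV.
by rewrite -actQ_actM mulVg actQ_act1.
Qed.

(** Writing the left half as [rev a] turns the mirror condition into [a == b]. *)
Lemma nested_cupE (y : seq S) (i : subexpr [::]) (e : subexpr (rev y ++ y))
    (a b : subexpr y) : tval e = rev a ++ b ->
  nested_cup V y i e =
    (a == b)%:R * act (endpoint C y b)^-1%g (zeta V b)^-1.
Proof.
move=> eE; have [|e1 e1E] := @subexprP (rev y ++ rev (rev y)) e.
  by rewrite size_tuple !size_cat !size_rev.
rewrite /nested_cup (@castLE _ _ _ _ _ _ _ _ _ i e1) // cupsE e1E eE.
rewrite -[size (rev y)](_ : size (rev a) = _) ?size_rev ?size_tuple //.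
rewrite drop_size_cat ?size_rev ?size_tuple //.
rewrite take_size_cat ?size_rev ?size_tuple // revK.
rewrite (inj_eq val_inj) eq_sym; case: eqP => [->|_]; last by rewrite mul0r.
by rewrite mul1r cup_coeff_rev.
Qed.

Lemma vertex_entry s t m (e : subexpr (alt s t m)) (e' : subexpr (alt t s m)) :
    endpoint C (alt s t m) e = endpoint C (alt t s m) e' ->
  vertex V s t m e e' = piQ V s t m / zeta V e'.
Proof.
rewrite /vertex; set x := alt s t m; set y := alt t s m => he.
(* The source of the tensor product with the nested cup is [x ++ [::]], so [e] is retyped. *)
have [|i0 i0E] := @subexprP (x ++ [::]) e; first by rewrite cats0 size_tuple.
pose A := castL (cats0 x) (catA x (rev y) y)
  (tensorL (idmor V (Lam C x)) (nested_cup V y)).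
pose B := tensorL (vertex_form V s t m) (idmor V (Lam C y)).
have AE (j : subexpr ((x ++ rev y) ++ y)) (a : subexpr x) (b c : subexpr y) :
    tval j = (a ++ rev b) ++ c ->
  A e j = (e == a)%:R * act (endpoint C x e)
            ((b == c)%:R * act (endpoint C y c)^-1%g (zeta V c)^-1).
  move=> jE; have [|j1 j1E] := @subexprP (x ++ (rev y ++ y)) j.
    by rewrite size_tuple catA.
  have [|j2 j2E] := @subexprP (rev y ++ y) (rev b ++ c).
    by rewrite !size_cat !size_rev !size_tuple.
  rewrite /A (@castLE _ _ _ _ _ _ _ _ _ i0 j1) //.
  rewrite (@tensorLE x x [::] _ _ _ _ _ e [tuple] a j2) //.
  - by rewrite (nested_cupE _ j2E).
  - by rewrite i0E; apply/esym/cats0.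
  - by rewrite j1E jE j2E catA.
(* Reversal inverts endpoints, so $f$ tests whether [a] and [b] have the same endpoint. *)
have BE (j : subexpr ((x ++ rev y) ++ y)) (a : subexpr x) (b c : subexpr y) :
    tval j = (a ++ rev b) ++ c ->
  B j e' = (if (endpoint C x a * (endpoint C y b)^-1 == 1)%g
            then piQ V s t m else 0) *
           act (endpoint C x a * (endpoint C y b)^-1)%g (c == e')%:R.
  move=> jE; have [|j1 j1E] := @subexprP (x ++ rev y) (a ++ rev b).
    by rewrite !size_cat !size_rev !size_tuple.
  rewrite /B (@tensorLE (x ++ rev y) [::] y y _ _ _ _ j1 c [tuple] e') //.
    have E : endpoint C (x ++ rev y) j1 =
        (endpoint C x a * (endpoint C y b)^-1)%g.
      by rewrite j1E endpoint_cat ?endpoint_rev ?size_tuple.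
    by rewrite -E.
  by rewrite j1E.
have jP (j : subexpr ((x ++ rev y) ++ y)) :
    exists (a : subexpr x) (b c : subexpr y), tval j = (a ++ rev b) ++ c.
  have [|a aE] := @subexprP x (take (size x) (take (size x + size y) j)).
    by rewrite !size_takel ?leq_addr // size_tuple !size_cat size_rev leq_addr.
  have [|b bE] := @subexprP y (rev (drop (size x) (take (size x + size y) j))).
    rewrite size_rev size_drop size_takel ?addKn //.
    by rewrite size_tuple !size_cat size_rev leq_addr.
  have [|c cE] := @subexprP y (drop (size x + size y) j).
    by rewrite size_drop size_tuple !size_cat size_rev addKn.
  by exists a, b, c; rewrite aE bE cE revK !cat_take_drop.
transitivity (\sum_(j : subexpr ((x ++ rev y) ++ y)) A e j * B j e'); first by [].
clearbody A B.
(* The only contributing index: the identity on $\underline x$ forces [a = e], the cups [b = c], the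
   identity on $\underline y$ [c = e']. *)
have [|j0 j0E] := @subexprP ((x ++ rev y) ++ y) ((e ++ rev e') ++ e').
  by rewrite !size_cat !size_rev !size_tuple.
rewrite (bigD1 j0) //= big1 ?addr0 => [|j jj0]; last first.
  have [a [b [c jE]]] := jP j; rewrite (AE _ _ _ _ jE) (BE _ _ _ _ jE).
  have [ea|_] := eqVneq e a; last by rewrite !mul0r.
  have [bc|_] := eqVneq b c; last by rewrite mul0r actQ0 mulr0 mul0r.
  have [ce|_] := eqVneq c e'; last by rewrite actQ0 !mulr0.
  by case/eqP: jj0; apply: val_inj; rewrite /= jE j0E ea bc ce.
(* By [he] the endpoint seen by $f$ is trivial, giving $\pi_{s,t}$, and the twist by [e] undoes the
   inverse endpoint of [e']. *)
rewrite (AE _ _ _ _ j0E) (BE _ _ _ _ j0E) !eqxx !mul1r he mulgV eqxx.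
by rewrite actQ1r mulr1 -actQ_actM mulgV actQ_act1 mulrC.
Qed.

End VertexCoefficients.

Theorem lemma2p11 (k : idomainType) (W : groupType) (S : eqType)
    (C : coxeterSystem W S) (V : realization k C)
    (hbal : balanced V) (hroot : forall u : S, alpha V u != 0)
    (s t : S) (hst : s != t)
    (m : nat) (hm : mcox C s t = m) (hfin : (0 < m)%N)
    (e : subexpr (alt s t m)) (e' : subexpr (alt t s m))
    (he : endpoint C (alt s t m) e = endpoint C (alt t s m) e') :
  vertex V s t m e e' = piQ V s t m / zeta V e'.
Proof. exact: vertex_entry. Qed.
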